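(* Let $\Gamma=(V,E)$ be a point-transitive, reflexive, locally finite relation and let $v\in V$. Let $F\subset V$ satisfy $F\cap\Gamma^-(v)=\{v\}$. (i) If $F$ is finite, then $|\Gamma(F)\setminus F|\ge|\Gamma(v)|-1$. (ii) If $F$ is cofinite (i.e. $V\setminus F$ is finite), then $|\Gamma(F)\setminus F|\ge|\Gamma^-(v)|-1$.
   Context: A relation is a pair $\Gamma=(V,E)$ with $E\subset V\times V$; for $X\subset V$, $\Gamma(X)=\{y: (x,y)\in E \text{ for some } x\in X\}$, $\Gamma^-(X)=\{y:(y,x)\in E\text{ for some }x\in X\}$, $\Gamma(x)=\Gamma(\{x\})$. $\Gamma$ is reflexive if $(x,x)\in E$ for all $x$, and locally finite if $\Gamma(x)$ and $\Gamma^-(x)$ are finite for all $x$. An automorphism is a bijection $f:V\to V$ with $\Gamma(f(x))=f(\Gamma(x))$ for all $x$; $\Gamma$ is point-transitive if for all $x,y\in V$ there is an automorphism $f$ with $f(x)=y$. *)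

(* Defs.v *)
From Stdlib Require Import List Arith.
Import ListNotations.

Section Rel.
Context {V : Type} (E : V -> V -> Prop).

Definition out_set (X : V -> Prop) : V -> Prop := fun y => exists x, X x /\ E x y.
Definition in_set (X : V -> Prop) : V -> Prop := fun y => exists x, X x /\ E y x.
Definition out1 (x : V) : V -> Prop := fun y => E x y.
Definition in1 (x : V) : V -> Prop := fun y => E y x.

Definition has_card (X : V -> Prop) (n : nat) : Prop :=
  exists l : list V, NoDup l /\ (forall y, X y <-> In y l) /\ length l = n.

Definition finite_set (X : V -> Prop) : Prop :=
  exists l : list V, forall y, X y <-> In y l.

Definition cofinite_set (X : V -> Prop) : Prop :=
  finite_set (fun y => ~ X y).

Definition reflexive_rel : Prop := forall x, E x x.

Definition locally_finite : Prop :=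
  forall x, finite_set (out1 x) /\ finite_set (in1 x).

Definition automorphism (f : V -> V) : Prop :=
  (forall x y, f x = f y -> x = y) /\ (forall y, exists x, f x = y) /\
  (forall x y, E (f x) y <-> exists z, E x z /\ f z = y).

Definition point_transitive : Prop :=
  forall x y, exists f, automorphism f /\ f x = y.

End Rel.

(* Main.v *)
From mathcomp Require Import all_boot finmap boolp zify.
Require Import Defs.

Set Implicit Arguments.
Unset Strict Implicit.
Unset Printing Implicit Defensive.

Local Open Scope fset_scope.

(** Write [bd X] for the boundary of [X], and take a nonempty finite [A] of
    minimal boundary (among sets whose neighbourhood is not everything, when
    [V] is finite).  Submodularity lets one replace [F] by its intersection
    with every [B] through [v] such that [|B| = |A|] and [|bd B| = |bd A|]:
    this keeps [v] isolated and does not increase [|bd F|].  The new [F] lies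
    in the class of [v] for the preorder "every such [B] containing [x]
    contains [y]", and by transitivity such a class [K] is a block of
    imprimitivity.  Induction applied to the relation induced on [K] bounds
    the part of the boundary inside [K], while the part outside [K] contains
    [N v \ K]; together they give the result.  When [V] is finite and [F] is
    too large for this uncrossing, the same argument is applied to the
    converse relation and to the set [v |` (V \ nbhd F)], whose boundary is
    contained in that of [F].  This same duality deduces the cofinite case
    from the finite one. *)

(** * Boundaries, automorphisms and submodularity *)

Section Boundary.
Variables (V : choiceType) (N : V -> {fset V}).
Implicit Types (X Y F A K : {fset V}) (f g : V -> V).

Definition nbhd X : {fset V} := \bigcup_(x <- X) N x.
Definition boundary X : {fset V} := nbhd X `\` X.
Definition is_aut f : Prop :=
  bijective f /\ forall x y, (f y \in N (f x)) = (y \in N x).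
Definition is_transitive : Prop := forall x y, exists2 f, is_aut f & f x = y.
Definition is_reflexive : Prop := forall x, x \in N x.
(** Written pointwise so that the in-neighbourhood of [v] need not be a finite set. *)
Definition isolates (v : V) F : Prop :=
  forall x, (x \in F) && (v \in N x) = (x == v).
Definition isolation_bound : Prop :=
  forall v F, isolates v F -> #|` N v| <= #|` boundary F|.+1.

Lemma nbhdP X y : reflect (exists2 x, x \in X & y \in N x) (y \in nbhd X).
Proof.
apply: (iffP (bigfcupP _ _ _ _)) => -[x xX yx]; exists x => //.
  by move: xX; rewrite andbT.
by rewrite xX.
Qed.

Lemma nbhdS X Y : X `<=` Y -> nbhd X `<=` nbhd Y.
Proof.
move=> /fsubsetP sXY; apply/fsubsetP => y /nbhdP[x xX yx].
by apply/nbhdP; exists x => //; apply: sXY.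
Qed.

Lemma nbhdU X Y : nbhd (X `|` Y) = nbhd X `|` nbhd Y.
Proof.
apply/eqP; rewrite eqEfsubset fsubUset !nbhdS ?fsubsetUl ?fsubsetUr // !andbT.
apply/fsubsetP => y /nbhdP[x /fsetUP[] xX yx]; apply/fsetUP; [left|right];
  by apply/nbhdP; exists x.
Qed.

Lemma nbhd1 v : nbhd [fset v] = N v.
Proof.
apply/fsetP => y; apply/nbhdP/idP => [[x /fset1P ->] //|yv].
by exists v; rewrite ?fset11.
Qed.

Lemma isolates_mem v F : isolates v F -> v \in F.
Proof. by move=> /(_ v); rewrite eqxx => /andP[]. Qed.

Lemma isolatesI v F A : isolates v F -> v \in A -> isolates v (F `&` A).
Proof.
move=> iF vA x; rewrite in_fsetI andbAC iF.
by case: eqP => // ->; rewrite vA.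
Qed.

Lemma aut_inv f :
  is_aut f -> exists2 g, is_aut g & cancel f g /\ cancel g f.
Proof.
case=> -[g fK gK] fN; exists g; last by split.
by split; [exists f | move=> x y; rewrite -fN !gK].
Qed.

Lemma card_aut f X : is_aut f -> #|` f @` X| = #|` X|.
Proof. by case=> /bij_inj f_inj _; apply: card_imfset. Qed.

Lemma mem_aut f X x : is_aut f -> (f x \in f @` X) = (x \in X).
Proof. by case=> /bij_inj f_inj _; rewrite mem_imfset. Qed.

Lemma nbhd_aut f X : is_aut f -> nbhd (f @` X) = f @` nbhd X.
Proof.
move=> fA; have [g gA [fK gK]] := aut_inv fA; have [_ fN] := fA.
apply/fsetP => y; rewrite -[y]gK mem_aut //.
apply/nbhdP/nbhdP => [[_ /imfsetP[x /= xX ->]]|[x xX]].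
  by rewrite fN => yx; exists x.
by rewrite -fN => yx; exists (f x); rewrite ?mem_aut.
Qed.

Lemma boundary_aut f X : is_aut f -> boundary (f @` X) = f @` boundary X.
Proof.
move=> fA; have [g _ [fK gK]] := aut_inv fA.
apply/fsetP => y; rewrite -[y]gK mem_aut // !in_fsetD nbhd_aut //.
by rewrite !mem_aut.
Qed.

Lemma card_nbhd_point x y : is_transitive -> #|` N x| = #|` N y|.
Proof.
move=> /(_ x y) [f fA <-]; rewrite -(card_aut (N x) fA) -!nbhd1 -nbhd_aut //.
congr #|` nbhd _|; apply/fsetP => z; apply/imfsetP/fset1P => [[w /= /fset1P ->]|->] //.
by exists x; rewrite //= fset11.
Qed.

Hypothesis N_refl : is_reflexive.

Lemma sub_nbhd X : X `<=` nbhd X.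
Proof. by apply/fsubsetP => x xX; apply/nbhdP; exists x. Qed.

Lemma card_nbhd X : #|` nbhd X| = (#|` X| + #|` boundary X|)%N.
Proof.
by rewrite /boundary cardfsDS ?sub_nbhd // subnKC // fsubset_leq_card ?sub_nbhd.
Qed.

(** [nbhd] commutes with unions and sends an intersection into the intersection of the images; by
    reflexivity the boundary size is a difference of cardinals, and the cardinals of the sets
    themselves are modular. *)
Lemma boundary_submod X Y :
  #|` boundary (X `&` Y)| + #|` boundary (X `|` Y)|
    <= #|` boundary X| + #|` boundary Y|.
Proof.
have sI : #|` nbhd (X `&` Y)| <= #|` nbhd X `&` nbhd Y|.
  by apply: fsubset_leq_card; rewrite fsubsetI !nbhdS ?fsubsetIl ?fsubsetIr.
have := cardfsUI (nbhd X) (nbhd Y); have := cardfsUI X Y.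
rewrite -nbhdU !card_nbhd; rewrite card_nbhd in sI; lia.
Qed.

(** If some [A] in [Q] does not contain [F], pass to the smaller set [F & A]: since the union has
    boundary at least that of [A], submodularity gives the intersection boundary at most that of
    [F]. Quantifying over all [F'] inside [F] keeps the hypothesis available along the recursion. *)
Lemma shrink_isolating v F (Q : {fset V} -> Prop) :
    isolates v F ->
    (forall F' A, F' `<=` F -> v \in F' -> Q A ->
      v \in A /\ #|` boundary A| <= #|` boundary (F' `|` A)|) ->
  exists F', [/\ isolates v F', #|` boundary F'| <= #|` boundary F|
    & forall A, Q A -> F' `<=` A].
Proof.
have [n] := ubnP #|` F|; elim: n F => // n IH F ltFn iF QF.
have [sFQ|] := pselect (forall A, Q A -> F `<=` A); first by exists F.
move=> /existsNP[A /not_implyP[QA /negP nsFA]].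
have [vA leA] := QF F A (fsubset_refl _) (isolates_mem iF) QA.
have ltI : #|` F `&` A| < #|` F|.
  apply: fproper_ltn_card; rewrite fproperE fsubsetIl /=.
  by apply: contra nsFA; rewrite fsubsetI => /andP[].
have [||F' [iF' leF' sF'Q]] := IH (F `&` A) _ (isolatesI iF vA).
- lia.
- by move=> F' B sF'; apply: QF; apply: fsubset_trans sF' (fsubsetIl _ _).
exists F'; split=> //; apply: leq_trans leF' _.
have := boundary_submod F A; lia.
Qed.

Hypothesis N_trans : is_transitive.

(* Up-sets of equal finite size force the invariant preorder [R] to be
   symmetric, so its classes are blocks of imprimitivity. *)
Lemma preorder_block (R : V -> V -> Prop) v K :
    (forall x, R x x) -> (forall x y z, R x y -> R y z -> R x z) ->
    (forall f x y, is_aut f -> R x y -> R (f x) (f y)) ->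
    (forall y, y \in K <-> R v y) ->
  forall x y, x \in K -> y \in K ->
    exists f, [/\ is_aut f, f x = y & forall z, z \in K -> f z \in K].
Proof.
move=> Rxx Rt Rf KR.
have Rsym x : R v x -> R x v.
  move=> vx; have [f fA fvx] := N_trans v x.
  have sfK : f @` K `<=` K.
    apply/fsubsetP => _ /imfsetP[z /= /KR vz ->]; apply/KR.
    by apply: (Rt _ _ _ vx); rewrite -fvx; apply: Rf.
  have : v \in f @` K.
    by rewrite ((fsubset_cardP (card_aut K fA)) sfK); apply/KR.
  by case/imfsetP => z /= /KR vz ->; rewrite -fvx; apply: Rf.
move=> x y /KR vx /KR vy; have [f fA fxy] := N_trans x y.
exists f; split=> // z /KR vz; apply/KR; apply: (Rt _ _ _ vy); rewrite -fxy.
exact: Rf _ _ _ fA (Rt _ _ _ (Rsym _ vx) vz).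
Qed.

End Boundary.

(** * Relations induced on a block *)

Section Restriction.
Variables (V : choiceType) (N : V -> {fset V}) (K : {fset V}).

Definition restrict_rel (x : K) : {fset K} := [fset y : K | val y \in N (val x)].

Lemma mem_restrict_rel x y : (y \in restrict_rel x) = (val y \in N (val x)).
Proof. by rewrite !inE. Qed.

Lemma restrict_rel_reflexive : is_reflexive N -> is_reflexive restrict_rel.
Proof. by move=> N_refl x; rewrite mem_restrict_rel. Qed.

Lemma restrict_rel_transitive :
    (forall x y, x \in K -> y \in K ->
      exists f, [/\ is_aut N f, f x = y & forall z, z \in K -> f z \in K]) ->
  is_transitive restrict_rel.
Proof.
move=> blockK x y; have [f [[f_bij fN] fxy fK]] := blockK _ _ (valP x) (valP y).
exists (fun z : K => [` fK _ (valP z)]); last exact: val_inj.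
split=> [|z t]; last by rewrite !mem_restrict_rel fN.
(* An injective self-map of the finite type [K] is bijective. *)
by apply: injF_bij => z t /(congr1 val) /= /(bij_inj f_bij); apply: val_inj.
Qed.

(** Since [v] is in [F] and [F] is inside [K], all of [N v \ K] lies in the boundary of [F],
    disjoint from the boundary computed inside [K]. *)
Lemma block_isolation_bound v (F : {fset V}) :
    isolation_bound restrict_rel -> F `<=` K -> isolates N v F ->
  #|` N v| <= #|` boundary N F|.+1.
Proof.
move=> boundK /fsubsetP sFK iF; have vF := isolates_mem iF.
pose v' : K := [` sFK _ vF]; pose F' : {fset K} := [fset x : K | val x \in F].
have mF' x : (x \in F') = (val x \in F) by rewrite !inE.
have iF' : isolates restrict_rel v' F'.
  by move=> x; rewrite mF' mem_restrict_rel iF.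
have {boundK} := boundK _ _ iF'.
have cardv (A : {fset K}) : #|` [fset val x | x in A]| = #|` A|.
  by apply: card_imfset; apply: val_inj.
rewrite -!cardv.
have -> : [fset val x | x in restrict_rel v'] = N v `&` K.
  apply/fsetP => y; rewrite in_fsetI; apply/imfsetP/andP => [[x /=]|[yv yK]].
    by rewrite mem_restrict_rel => xv ->; split=> //; apply: valP.
  by exists [` yK]; rewrite //= mem_restrict_rel.
have : #|` [fset val x | x in boundary restrict_rel F']| + #|` N v `\` K|
         <= #|` boundary N F|.
  have /eqP <- : #|` [fset val x | x in boundary restrict_rel F'] `|` (N v `\` K)|
      == (#|` [fset val x | x in boundary restrict_rel F']| + #|` N v `\` K|)%N.
    rewrite (leq_card_fsetU _ _); apply/fdisjointP => _ /imfsetP[x /= _ ->].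
    by rewrite in_fsetD (valP x).
  apply: fsubset_leq_card; rewrite fsubUset; apply/andP; split; apply/fsubsetP.
    move=> _ /imfsetP[x /= /fsetDP[/nbhdP[z zF' xz] xF'] ->].
    apply/fsetDP; split; last by rewrite -mF'.
    by apply/nbhdP; exists (val z); rewrite -?mF' -?mem_restrict_rel.
  move=> y /fsetDP[yv yK]; apply/fsetDP; split.
    by apply/nbhdP; exists v.
  by apply: contra yK; apply: sFK.
by have := cardfsID K (N v); lia.
Qed.

End Restriction.

(** * Uncrossing with minimal fragments *)

Section Fragment.
Variables (V : choiceType) (N : V -> {fset V}).
Hypotheses (N_refl : is_reflexive N) (N_trans : is_transitive N).
Variable A : {fset V}.
Hypothesis A_neq0 : A != fset0.

(** Only the two cardinals matter: this family contains [A] and is stable under automorphisms, which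
    makes the preorder built from it invariant. *)
Definition congruent (B : {fset V}) : Prop :=
  #|` B| = #|` A| /\ #|` boundary N B| = #|` boundary N A|.

Lemma congruent_aut f B : is_aut N f -> congruent B -> congruent (f @` B).
Proof.
by move=> fA [cB bB]; rewrite /congruent boundary_aut // !(card_aut _ fA).
Qed.

(** Minimality of [A] enters only through the last hypothesis, asked just for the unions met while
    shrinking [F]; the finite and the general case establish it differently. *)
Lemma fragment_bound v F :
    isolates N v F ->
    (forall K : {fset V}, #|` K| <= #|` A| -> is_transitive (restrict_rel N (K := K)) ->
      isolation_bound (restrict_rel N (K := K))) ->
    (forall F' B, F' `<=` F -> v \in F' -> congruent B -> v \in B ->
      #|` boundary N A| <= #|` boundary N (F' `|` B)|) ->
  #|` N v| <= #|` boundary N F|.+1.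
Proof.
move=> iF IH leU.
pose R x y := forall B, congruent B -> x \in B -> y \in B.
have [x0 x0A] := fset0Pn _ A_neq0; have [f fA fx0] := N_trans x0 v.
have cfA : congruent (f @` A) by apply: congruent_aut.
have vfA : v \in f @` A by rewrite -fx0 (mem_aut _ _ fA).
(* The image of [A] is congruent to [A] and contains [v], so it contains every [y] with [R v y]; the
   class is thus finite even if [V] is not. *)
pose K := [fset y in f @` A | `[< R v y >]].
have KR y : y \in K <-> R v y.
  rewrite !inE; split=> [/andP[_ /asboolP] //|vy]; apply/andP; split; last exact/asboolP.
  exact: vy.
have blockK : forall x y, x \in K -> y \in K ->
    exists f, [/\ is_aut N f, f x = y & forall z, z \in K -> f z \in K].
  apply: (preorder_block N_trans (R := R)) KR => [x B //|x y z xy yz B cB /xy|g x y gA xy B cB].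
    by move=> /(_ cB); apply: yz.
  have [h hA [gK hK]] := aut_inv gA.
  have := xy (h @` B) (congruent_aut hA cB).
  by rewrite -{1}[x]gK -{1}[y]gK !(mem_aut _ _ hA).
have [|F' [iF' leF' sF'K]] := shrink_isolating N_refl
  (Q := fun B => congruent B /\ v \in B) iF.
  by move=> F' B sF' vF' [cB vB]; split; rewrite // cB.2; apply: leU.
apply: leq_trans (_ : #|` boundary N F'|.+1 <= _); last by [].
apply: (block_isolation_bound (K := K)) => //.
  apply: IH; last exact: restrict_rel_transitive.
  rewrite -(card_aut A fA); apply: fsubset_leq_card.
  by apply/fsubsetP => y /KR vy; apply: vy.
apply/fsubsetP => y yF'; apply/KR => B cB vB.
by apply: (fsubsetP (sF'K B _)).
Qed.

End Fragment.

Lemma card_fsetT_sub (V : choiceType) (K : {fset V}) : #|` [fset x : K | true]| = #|` K|.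
Proof.
transitivity #|` [fset val x | x in [fset x : K | true]]|.
  by apply/esym/card_imfset; apply: val_inj.
congr #|` _|.
apply/fsetP => y; apply/imfsetP/idP => [[x _ ->]|yK]; first exact: valP.
by exists [` yK]; rewrite // !inE.
Qed.

(** * The converse relation and duality *)

Section FiniteConverse.
Variables (V : choiceType) (U : {fset V}) (N : V -> {fset V}).
Hypothesis U_full : forall x, x \in U.

Definition converse (y : V) : {fset V} := [fset x in U | y \in N x].

Lemma mem_converse x y : (x \in converse y) = (y \in N x).
Proof. by rewrite !inE U_full. Qed.

Lemma converse_reflexive : is_reflexive N -> is_reflexive converse.
Proof. by move=> N_refl x; rewrite mem_converse. Qed.

Lemma converse_aut f : is_aut N f -> is_aut converse f.
Proof. by move=> [f_bij fN]; split=> // x y; rewrite !mem_converse. Qed.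

Lemma converse_transitive : is_transitive N -> is_transitive converse.
Proof.
by move=> N_trans x y; have [f fA fxy] := N_trans x y; exists f => //; apply: converse_aut.
Qed.

Lemma card_sum_mem (X : {fset V}) : #|` X| = \sum_(y <- U) (y \in X).
Proof.
rewrite -big_mkcond /= sum1_count -size_filter; apply/perm_size/uniq_perm => //.
  exact: filter_uniq.
by move=> y; rewrite mem_filter U_full andbT.
Qed.

(** Double counting of the related pairs: by transitivity all out-degrees agree and all in-degrees
    agree, so the factor [|U|], nonzero because of [v], cancels. *)
Lemma card_converse v : is_transitive N -> #|` converse v| = #|` N v|.
Proof.
move=> N_trans.
have : \sum_(x <- U) #|` converse x| = \sum_(x <- U) #|` N x|.
  under eq_bigr do rewrite card_sum_mem.
  under [RHS]eq_bigr do rewrite card_sum_mem.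
  rewrite exchange_big /=; apply: eq_bigr => x _; apply: eq_bigr => y _.
  by rewrite mem_converse.
under eq_bigr do rewrite (card_nbhd_point _ v (converse_transitive N_trans)).
under [RHS]eq_bigr do rewrite (card_nbhd_point _ v N_trans).
rewrite !big_const_seq !iter_addn_0 => /eqP; rewrite eqn_mul2r => /orP[|/eqP //].
by rewrite count_predT -/(#|` U|) cardfs_eq0 => /eqP U0; have := U_full v; rewrite U0.
Qed.

End FiniteConverse.

Lemma boundary_co_nbhd (V : choiceType) (N M : V -> {fset V}) (U X : {fset V}) :
    (forall x, x \in U) -> (forall x y, (x \in M y) = (y \in N x)) ->
  boundary M (U `\` nbhd N X) `<=` boundary N X.
Proof.
move=> U_full MN; apply/fsubsetP => x /fsetDP[/nbhdP[c /fsetDP[_ cX]]].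
rewrite MN in_fsetD U_full andbT negbK => cx xX; apply/fsetDP; split=> //.
by apply: contra cX => xX'; apply/nbhdP; exists x.
Qed.

(** Every [M]-in-neighbour of [v] is in [N v], hence in [nbhd N F], so only [v] itself meets the new
    set. Adding [v] puts no point of [F] in the boundary, because the only in-neighbour of [v] in
    [F] is [v]. *)
Lemma isolates_co_nbhd (V : choiceType) (N M : V -> {fset V}) (U F : {fset V}) v :
    (forall x, x \in U) -> (forall x y, (x \in M y) = (y \in N x)) ->
    is_reflexive N -> isolates N v F ->
  isolates M v (v |` (U `\` nbhd N F)) /\
  boundary M (v |` (U `\` nbhd N F)) `<=` boundary N F.
Proof.
move=> U_full MN N_refl iF; have vF := isolates_mem iF; split.
  move=> x; rewrite MN in_fset1U in_fsetD U_full andbT.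
  case: eqP => [->|_] /=; first by rewrite N_refl.
  by apply/negbTE/andP => -[/nbhdP xF xv]; apply: xF; exists v.
apply/fsubsetP => x /fsetDP[/nbhdP[c]]; rewrite MN !in_fset1U !in_fsetD.
rewrite !U_full !andbT negb_or negbK => cG cx /andP[xv ->]; rewrite andbT.
case/orP: cG => [/eqP cv|]; last first.
  by apply: contra => xF; apply/nbhdP; exists x.
by apply: contra xv => xF; rewrite -iF xF -cv.
Qed.

(** * The induction step for finite [V] *)

Section FiniteStep.
Variables (V : choiceType) (U : {fset V}) (N : V -> {fset V}).
Hypotheses (U_full : forall x, x \in U).
Hypotheses (N_refl : is_reflexive N) (N_trans : is_transitive N).
Variable A : {fset V}.
Hypotheses (A_neq0 : A != fset0) (A_sep : nbhd N A != U).
Hypothesis A_min : forall X : {fset V}, X != fset0 -> nbhd N X != U ->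
  #|` boundary N A| <= #|` boundary N X|.
Let M := converse U N.

Let MN x y : (x \in M y) = (y \in N x). Proof. exact: mem_converse. Qed.
Let M_refl : is_reflexive M. Proof. exact: converse_reflexive. Qed.

Lemma sub_full (X : {fset V}) : X `<=` U. Proof. exact/fsubsetP. Qed.

Lemma nbhd_lt_full (X : {fset V}) : nbhd N X != U -> #|` X| + #|` boundary N X| < #|` U|.
Proof. by move=> neU; rewrite -card_nbhd // fproper_ltn_card // fproperEneq neU sub_full. Qed.

Lemma min_le_boundary X : X != fset0 -> #|` X| + #|` boundary N A| <= #|` U| ->
  #|` boundary N A| <= #|` boundary N X|.
Proof.
move=> X0 leX; have [XU|] := eqVneq (nbhd N X) U; last exact: A_min.
by move: (card_nbhd N_refl X); rewrite XU; lia.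
Qed.

(** If [nbhd M X] is not everything, its complement is nonempty, its [N]-neighbourhood misses [X],
    and its [N]-boundary lies in the [M]-boundary of [X]; minimality of [A] applies to it. *)
Lemma min_le_boundary_converse X : X != fset0 -> #|` X| + #|` boundary N A| <= #|` U| ->
  #|` boundary N A| <= #|` boundary M X|.
Proof.
move=> X0 leX; have [XU|neU] := eqVneq (nbhd M X) U.
  by move: (card_nbhd M_refl X); rewrite XU; lia.
apply: leq_trans (fsubset_leq_card (boundary_co_nbhd X U_full (fun x y => esym (MN y x)))).
apply: A_min; first by apply: contra neU; rewrite fsetD_eq0 eqEfsubset sub_full.
have [x xX] := fset0Pn _ X0; apply: contraNneq (_ : x \notin nbhd N (U `\` nbhd M X)) => [->//|].
apply/nbhdP => -[y /fsetDP[_ yX] xy]; case/negP: yX; apply/nbhdP; exists x => //.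
by rewrite MN.
Qed.

(** The induction hypothesis covers every relation [P] because it is used for restrictions of [N]
    and of its converse. *)
Lemma finite_step v F :
    isolates N v F ->
    (forall (K : {fset V}) (P : V -> {fset V}), #|` K| < #|` U| -> is_reflexive P ->
      is_transitive (restrict_rel P (K := K)) ->
      isolation_bound (restrict_rel P (K := K))) ->
    #|` boundary N A| <= #|` boundary N F| ->
  #|` N v| <= #|` boundary N F|.+1.
Proof.
move=> iF IH leAF; have vF := isolates_mem iF.
have ltA := nbhd_lt_full A_sep.
have cardF := card_nbhd N_refl F.
(* If [F] is too large to be uncrossed with the fragments through [v], then
   its dual [G] is small enough to be uncrossed, for the converse relation,
   with the complements of the sets [nbhd N B], [B] congruent to [A]. *)
have [small|large] := leqP (#|` F| + #|` A| + #|` boundary N A|) #|` U|.+1.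
  apply: (fragment_bound N_refl N_trans A_neq0 iF) => [K leK|F' B sF' vF' [cB _] vB].
    by apply: IH => //; lia.
  (* Both sets contain [v], so their union has at most [|F| + |A| - 1] points; this is the [.+1] in
     the case split. *)
  apply: min_le_boundary; first by apply/fset0Pn; exists v; rewrite in_fsetU vB orbT.
  have : 0 < #|` F' `&` B| by rewrite cardfs_gt0; apply/fset0Pn; exists v; rewrite in_fsetI vF'.
  by have := cardfsUI F' B; have := fsubset_leq_card sF'; lia.
rewrite -(card_converse U_full v N_trans) -/M.
have [iG leG] := isolates_co_nbhd U_full MN N_refl iF.
set G := v |` _ in iG leG; have {}leG := fsubset_leq_card leG.
(* [G] has at most [|U| + 1 - |F| - |bd F|] points; combine [large] with [leAF]. *)
have cardG : #|` G| <= #|` A|.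
  rewrite cardfsU1 cardfsDS ?sub_full //.
  by have := fsubset_leq_card (sub_full (nbhd N F)); case: (_ \notin _); lia.
(* By contraposition: every complement of such an [nbhd N B] containing [x] contains [y]. *)
pose R x y := forall B, congruent N A B -> y \in nbhd N B -> x \in nbhd N B.
pose K := [fset y in U | `[< R v y >]].
have KR y : y \in K <-> R v y by rewrite !inE U_full; split=> /asboolP.
have blockK : forall x y, x \in K -> y \in K ->
    exists f, [/\ is_aut M f, f x = y & forall z, z \in K -> f z \in K].
  move=> x y xK yK; suff [f [fA fxy fK]] : exists f,
      [/\ is_aut N f, f x = y & forall z, z \in K -> f z \in K].
    by exists f; split=> //; apply: converse_aut.
  move: x y xK yK; apply: (preorder_block N_trans (R := R)) KR
      => [x B //|x y z xy yz B cB /(yz B cB)|g x y gA xy B cB]; first exact: xy.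
  have [h hA [gK hK]] := aut_inv gA.
  have := xy (h @` B) (congruent_aut hA cB).
  by rewrite (nbhd_aut _ hA) -{1}[x]gK -{1}[y]gK !(mem_aut _ _ hA).
have [|G' [iG' leG' sG'K]] := shrink_isolating M_refl
  (Q := fun C => exists2 B, congruent N A B & C = U `\` nbhd N B /\ v \in C) iG.
  move=> G' _ sG' vG' [B [cB bB] [-> vC]]; split=> //.
  apply: leq_trans (fsubset_leq_card (boundary_co_nbhd B U_full MN)) _; rewrite bB.
  set C := _ `\` _ in vC *.
  apply: min_le_boundary_converse; first by apply/fset0Pn; exists v; rewrite in_fsetU vC orbT.
  (* [C] has [|U| - |A| - |bd A|] points and [G'] at most [|A|], so the union is small enough for
     the preceding bound. *)
  have : 0 < #|` G' `&` C| by rewrite cardfs_gt0; apply/fset0Pn; exists v; rewrite in_fsetI vG'.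
  have cC : (#|` C| + #|` nbhd N B| = #|` U|)%N.
    by rewrite cardfsDS ?sub_full // subnK // fsubset_leq_card // sub_full.
  have := card_nbhd N_refl B.
  by have := cardfsUI G' C; have := fsubset_leq_card sG'; lia.
apply: leq_trans (_ : #|` boundary M G'|.+1 <= _); last by lia.
apply: (block_isolation_bound (K := K)) => //.
  apply: IH => //; last exact: restrict_rel_transitive.
  (* [K] is proper: move a point outside [nbhd N A] to [v]; the image of a point of [A] is then not
     above [v] for [R]. *)
  have [y0 y0A] : exists y0, y0 \notin nbhd N A.
    apply/not_existsP => nA; case/negP: A_sep; rewrite eqEfsubset sub_full.
    by apply/fsubsetP => y _; apply/negPn/negP => /nA.
  have [f fA fy0] := N_trans y0 v; have [x0 x0A] := fset0Pn _ A_neq0.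
  apply: fproper_ltn_card; rewrite fproperE sub_full /=; apply/fsubsetPn.
  exists (f x0) => //; apply/negP => /KR /(_ (f @` A)).
  rewrite -fy0 (nbhd_aut _ fA) !(mem_aut _ _ fA) (negbTE y0A).
  move=> absurd; suff: false by [].
  by apply: absurd; [exact: congruent_aut | exact: (fsubsetP (sub_nbhd N_refl A))].
apply/fsubsetP => y yG'; apply/KR => B cB yB; apply/negPn/negP => vB.
have /fsubsetP /(_ y yG') : G' `<=` U `\` nbhd N B.
  by apply: sG'K; exists B; rewrite // in_fsetD vB U_full.
by rewrite in_fsetD yB.
Qed.

End FiniteStep.

(** * The bound for finite sets, by induction and in general *)

Lemma exists_argmin (T : Type) (P : T -> Prop) (m : T -> nat) :
  (exists x, P x) -> exists2 x, P x & forall y, P y -> m x <= m y.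
Proof.
move=> exP; have exQ : exists n, `[< exists2 x, P x & m x = n >].
  by case: exP => x Px; exists (m x); apply/asboolP; exists x.
case: (ex_minnP exQ) => n /asboolP[x Px mx] n_min; exists x => // y Py.
by rewrite mx; apply: n_min; apply/asboolP; exists y.
Qed.

Lemma finite_isolation_bound (V : choiceType) (U : {fset V}) (N : V -> {fset V}) :
  (forall x, x \in U) -> is_reflexive N -> is_transitive N -> isolation_bound N.
Proof.
have [n] := ubnP #|` U|; elim: n V U N => // n IH V U N ltUn U_full N_refl N_trans v F iF.
have vF := isolates_mem iF.
(* [nbhd N F] may be all of [U], so [F] need not compete with [A]. But [nbhd N X] misses [v] by
   isolation, so [X] does compete, and its boundary lies in that of [F]. *)
pose X := F `\ v; have [X0|Xn0] := eqVneq X fset0.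
  have -> : F = [fset v].
    by apply/eqP; rewrite eqEfsubset fsub1set vF andbT -fsetD_eq0 -/X X0.
  by have := card_nbhd N_refl [fset v]; rewrite nbhd1 cardfs1; lia.
have vX : v \notin nbhd N X.
  by apply/nbhdP => -[x /fsetD1P[xv xF] vx]; move: xv; rewrite -iF xF vx.
have leXF : #|` boundary N X| <= #|` boundary N F|.
  apply/fsubset_leq_card/fsubsetP => y /fsetDP[yX nyX]; apply/fsetDP; split.
    exact: (fsubsetP (nbhdS N (fsubsetDl _ _)) _ yX).
  apply: contra nyX => yF; rewrite !inE yF andbT.
  by apply: contraNneq vX => <-.
have sepX : nbhd N X != U by apply: contraNneq vX => ->.
have [|A [A0 A_sep] A_min] := exists_argmin
  (P := fun Y : {fset V} => Y != fset0 /\ nbhd N Y != U) (fun Y => #|` boundary N Y|).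
  by exists X.
apply: (finite_step U_full N_refl N_trans A0 A_sep _ iF).
- by move=> Y Y0 Y_sep; apply: A_min.
- move=> K P ltK P_refl K_trans; apply: (IH K [fset x : K | true]) => //.
  + by rewrite card_fsetT_sub; lia.
  + by move=> x; rewrite !inE.
  + exact: restrict_rel_reflexive.
- by apply: leq_trans leXF; apply: A_min.
Qed.

(** Minimising over all nonempty finite sets lets every union compete directly; the block is finite,
    so the finite case handles it. *)
Lemma transitive_isolation_bound (V : choiceType) (N : V -> {fset V}) :
  is_reflexive N -> is_transitive N -> isolation_bound N.
Proof.
move=> N_refl N_trans v F iF.
have [|A A0 A_min] := exists_argmin
  (P := fun Y : {fset V} => Y != fset0) (fun Y => #|` boundary N Y|).
  by exists [fset v]; apply/fset0Pn; exists v; rewrite fset11.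
apply: (fragment_bound N_refl N_trans A0 iF) => [K _ K_trans|F' B _ _ _ vB].
  apply: (@finite_isolation_bound K [fset x : K | true]) => // [x|].
    by rewrite !inE.
  exact: restrict_rel_reflexive.
by apply: A_min; apply/fset0Pn; exists v; rewrite in_fsetU vB orbT.
Qed.

(** * Passage from predicates and lists to finite sets *)

Section FromLists.
Variable V : Type.
Implicit Types (X : V -> Prop) (A : {fset {classic V}}).

Lemma In_mem (s : seq {classic V}) x : List.In x s <-> x \in s.
Proof.
elim: s => //= y s IH; rewrite in_cons; split=> [[->|/IH ->]|].
- by rewrite eqxx.
- by rewrite orbT.
by case/orP => [/eqP ->|/IH]; [left|right].
Qed.

Lemma finite_set_fset X : finite_set X -> exists A, forall y, y \in A <-> X y.
Proof.
move=> [l lX]; exists [fset y in (l : seq {classic V})] => y.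
by rewrite lX In_mem !inE.
Qed.

Lemma has_card_fset X A : (forall y, y \in A <-> X y) -> has_card X #|` A|.
Proof.
move=> AX; exists (A : seq {classic V}); split; last split=> //.
  have := fset_uniq A.
  elim: (A : seq _) => [_|x s IH /= /andP[xs us]]; first exact: List.NoDup_nil.
  by apply: List.NoDup_cons; [rewrite In_mem; apply/negP | apply: IH].
by move=> y; rewrite -AX In_mem.
Qed.

End FromLists.

Lemma flip_point_transitive (V : Type) (E : V -> V -> Prop) :
  point_transitive E -> point_transitive (fun x y => E y x).
Proof.
move=> Etr x y; have [f [[f_inj [f_surj fE]] fxy]] := Etr x y.
exists f; split=> //; split=> //; split=> // a b; have [c <-] := f_surj b.
rewrite fE; split=> [[z [cz /f_inj <-]]|[z [zc /f_inj <-]]].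
  by exists c.
by exists a.
Qed.

(** [D] may be any finite set containing the boundary: in the cofinite case it is the boundary of
    the original [F], while the lemma is applied to the dual set. *)
Lemma finite_isolation_card (V : Type) (E : V -> V -> Prop)
    (v : V) (F : V -> Prop) (D : {fset {classic V}}) :
    point_transitive E -> reflexive_rel E ->
    (forall x, finite_set (out1 E x)) ->
    (forall x, (F x /\ E x v) <-> x = v) -> finite_set F ->
    (forall y, out_set E F y -> ~ F y -> y \in D) ->
  exists2 m, has_card (out1 E v) m & m <= #|` D|.+1.
Proof.
move=> Etr Erefl Elf HF finF FD.
have [N NE] := choice (fun x => finite_set_fset (Elf x)).
have [F' F'F] := finite_set_fset finF.
exists #|` N v|; first by apply: has_card_fset => y; rewrite NE.
have iF : isolates (V := {classic V}) N v F'.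
  move=> x; apply/andP/eqP; first by rewrite F'F NE => /HF.
  by move=> /HF; rewrite F'F NE.
apply: leq_trans (transitive_isolation_bound _ _ iF) _.
- by move=> x; apply/NE; apply: Erefl.
- move=> x y; have [f [[f_inj [f_surj fE]] fxy]] := Etr x y; exists f => //; split.
    have [g gK] := choice f_surj; exists g => // z; apply: f_inj; exact: gK.
  move=> a b; apply/idP/idP; rewrite !NE /out1 fE.
    by case=> z [az /f_inj <-].
  by move=> ab; exists b.
rewrite ltnS; apply/fsubset_leq_card/fsubsetP => y /fsetDP[/nbhdP[x xF xy] yF].
apply: FD; first by exists x; split; [apply/F'F | apply/NE].
by move=> /F'F; apply/negP.
Qed.

Theorem theorem5p1 (V : Type) (E : V -> V -> Prop)
  (Htrans : point_transitive E) (Hrefl : reflexive_rel E)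
  (Hlf : locally_finite E) (v : V) (F : V -> Prop)
  (HF : forall x, (F x /\ E x v) <-> x = v) :
  (finite_set F ->
     exists n m, has_card (fun y => out_set E F y /\ ~ F y) n /\
                 has_card (out1 E v) m /\ (m - 1 <= n)%coq_nat) /\
  (cofinite_set F ->
     exists n m, has_card (fun y => out_set E F y /\ ~ F y) n /\
                 has_card (in1 E v) m /\ (m - 1 <= n)%coq_nat).
Proof.
have [Fv _] := proj2 (HF v) erefl.
split=> [finF|cofF].
  have [N NE] := choice (fun x => finite_set_fset (proj1 (Hlf x))).
  have [F' F'F] := finite_set_fset finF.
  have DE y : y \in boundary (V := {classic V}) N F' <-> out_set E F y /\ ~ F y.
    split=> [/fsetDP[/nbhdP[x /F'F xF /NE xy] /negP yF]|[[x [xF xy]] yF]].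
      by split; [exists x | move=> /F'F].
    by apply/fsetDP; split; [apply/nbhdP; exists x; [apply/F'F|apply/NE]|apply/negP => /F'F].
  have [|m mE lem] := finite_isolation_card Htrans Hrefl (fun x => proj1 (Hlf x)) HF finF
    (D := boundary (V := {classic V}) N F').
    by move=> y Fy nFy; apply/DE.
  exists #|` boundary (V := {classic V}) N F'|, m; split; first exact: has_card_fset.
  by split=> //; apply/leP; rewrite leq_subLR.
have [C CF] := finite_set_fset cofF.
pose D := [fset y in C | `[< out_set E F y >]].
have DE y : y \in D <-> out_set E F y /\ ~ F y.
  rewrite !inE; split=> [/andP[/CF yF /asboolP]|[yF /CF ->]] //.
  exact/asboolP.
(* The dual set, as in [isolates_co_nbhd]; it is finite since by reflexivity the complement of
   [out_set E F] lies in that of [F]. *)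
pose G y := y = v \/ ~ out_set E F y.
have [|||m mE lem] := @finite_isolation_card V (fun x y => E y x) v G D
    (flip_point_transitive Htrans) Hrefl (fun x => proj2 (Hlf x)).
- move=> x; split=> [[[//|nFx] vx]|->]; last by split; [left | apply: Hrefl].
  by case: nFx; exists v.
- exists ((v : {classic V}) :: [seq y <- C | `[< G y >]]) => y /=.
  rewrite In_mem mem_filter; split=> [Gy|[<-|/andP[/asboolP]//]]; last by left.
  case: (Gy) => [->|nFy]; [by left|right]; apply/andP; split; first exact/asboolP.
  by apply/CF => Fy; apply: nFy; exists y; split=> //; apply: Hrefl.
- move=> y [x [Gx yx]] nGy; apply/DE; split.
    by apply: contrapT => nFy; apply: nGy; right.
  move=> Fy; case: Gx => [xv|]; last by apply; exists y.
  by apply: nGy; left; apply/HF; rewrite -xv.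
- exists #|` D|, m; split; first exact: has_card_fset.
  by split=> //; apply/leP; rewrite leq_subLR.
Qed.
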